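(* Let $n\ge2$, let $T$ be a strict t-norm, let $p,q>0$, and let $\alpha_1,\dots,\alpha_n$ be picture fuzzy numbers that are all equal, i.e. $\alpha_i=\alpha$ for all $i=1,\dots,n$. Then $$\mathrm{PFIBM}_T^{p,q}(\alpha_1,\dots,\alpha_n)=\alpha.$$
   Context: A picture fuzzy number (PFN) is a triple $\alpha=\langle\mu,\eta,\nu\rangle$ with $\mu,\eta,\nu\in[0,1]$ and $\mu+\eta+\nu\le1$. A t-norm is a commutative, associative map $T:[0,1]^2\to[0,1]$, nondecreasing in each variable, with $T(1,x)=x$. It is strict if it is continuous and $T(x,y)<T(x,z)$ whenever $x>0$ and $y<z$. A strict t-norm has a continuous additive generator: a continuous strictly decreasing bijection $\tau:[0,1]\to[0,+\infty]$ with $\tau(1)=0$, $\tau(0)=+\infty$ and $T(x,y)=\tau^{-1}(\tau(x)+\tau(y))$. Its dual t-conorm is $S(x,y)=1-T(1-x,1-y)=\zeta^{-1}(\zeta(x)+\zeta(y))$, where $\zeta(x)=\tau(1-x)$. Arithmetic in $[0,+\infty]$ is the usual one ($a+\infty=\infty$, $\lambda\cdot\infty=\infty$ for $\lambda>0$). For a strict t-norm $T$, PFNs $\alpha_k=\langle\mu_k,\eta_k,\nu_k\rangle$ ($k=1,2$), $\alpha=\langle\mu,\eta,\nu\rangle$ and $\lambda>0$ define: $\alpha_1\oplus\alpha_2=\langle S(\mu_1,\mu_2),\,T(\eta_1+\nu_1,\eta_2+\nu_2)-T(\nu_1,\nu_2),\,T(\nu_1,\nu_2)\rangle$; $\alpha_1\otimes\alpha_2=\langle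 T(\mu_1,\mu_2),\,T(\eta_1+\mu_1,\eta_2+\mu_2)-T(\mu_1,\mu_2),\,S(\nu_1,\nu_2)\rangle$; $\lambda\cdot\alpha=\langle\zeta^{-1}(\lambda\zeta(\mu)),\,\tau^{-1}(\lambda\tau(\eta+\nu))-\tau^{-1}(\lambda\tau(\nu)),\,\tau^{-1}(\lambda\tau(\nu))\rangle$; $\alpha^\lambda=\langle\tau^{-1}(\lambda\tau(\mu)),\,\tau^{-1}(\lambda\tau(\eta+\mu))-\tau^{-1}(\lambda\tau(\mu)),\,\zeta^{-1}(\lambda\zeta(\nu))\rangle$. These operations send PFNs to PFNs, and $\oplus,\otimes$ are commutative and associative (known facts), so iterated $\bigoplus$ is well defined. For $p,q>0$ the picture fuzzy interactional Bonferroni mean induced by $T$ is $$\mathrm{PFIBM}_T^{p,q}(\alpha_1,\dots,\alpha_n)=\Big[\tfrac1{n(n-1)}\cdot\bigoplus_{i,j=1,\ i\ne j}^n(\alpha_i^p\otimes\alpha_j^q)\Big]^{\frac1{p+q}}.$$ *)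

(* Defs.v *)
From HB Require Import structures.
From mathcomp Require Import all_boot all_order all_algebra.
From mathcomp Require Import all_classical all_reals all_analysis.

Set Implicit Arguments.
Unset Strict Implicit.
Unset Printing Implicit Defensive.

Import Order.TTheory GRing.Theory Num.Theory.
Import numFieldNormedType.Exports.

Local Open Scope classical_set_scope.
Local Open Scope ring_scope.

Definition unitI (R : realType) : set R := `[0, 1].
Arguments unitI {R}.

(* Maps on [0,1] are total functions on R; all requirements below concern
   their values on [0,1] only. *)

Record tnorm (R : realType) (T : R -> R -> R) : Prop := Tnorm {
  tnorm_unit : forall x y, unitI x -> unitI y -> unitI (T x y);
  tnormC : forall x y, unitI x -> unitI y -> T x y = T y x;
  tnormA : forall x y z, unitI x -> unitI y -> unitI z ->
    T x (T y z) = T (T x y) z;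
  tnorm_homol : forall x y z, unitI x -> unitI y -> unitI z ->
    x <= y -> T x z <= T y z;
  tnorm_homor : forall x y z, unitI x -> unitI y -> unitI z ->
    y <= z -> T x y <= T x z;
  tnorm1l : forall x, unitI x -> T 1 x = x }.

Record strict_tnorm (R : realType) (T : R -> R -> R) : Prop := StrictTnorm {
  strict_tnorm_tnorm : tnorm T;
  strict_tnorm_continuous :
    {within unitI `*` unitI, continuous (fun z : R * R => T z.1 z.2)};
  strict_tnorm_lt : forall x y z, unitI x -> unitI y -> unitI z ->
    0 < x -> y < z -> T x y < T x z }.

(* Inverse of a map from [0,1] to [0,+oo], with junk value 0 outside of the
   range of f. *)
Definition unit_inv (R : realType) (f : R -> \bar R) : \bar R -> R :=
  'pinv_(fun=> 0) unitI f.

Record additive_generator (R : realType) (T : R -> R -> R)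
    (tau : R -> \bar R) : Prop := AdditiveGenerator {
  generator_continuous : {within unitI, continuous tau};
  generator_decreasing : forall x y, unitI x -> unitI y ->
    x < y -> (tau y < tau x)%E;
  generator_bij : set_bij unitI `[0%E, +oo%E] tau;
  generator1 : tau 1 = 0%E;
  generator0 : tau 0 = +oo%E;
  generatorE : forall x y, unitI x -> unitI y ->
    T x y = unit_inv tau (tau x + tau y)%E }.

Definition dual_tconorm (R : realType) (T : R -> R -> R) (x y : R) : R :=
  1 - T (1 - x) (1 - y).

Definition dual_generator (R : realType) (tau : R -> \bar R) (x : R) : \bar R :=
  tau (1 - x).

Record triple (R : realType) : Type := Triple {
  pmu : R;
  peta : R;
  pnu : R }.

Definition is_pfn (R : realType) (a : triple R) : Prop :=
  [/\ unitI (pmu a), unitI (peta a), unitI (pnu a)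
    & pmu a + peta a + pnu a <= 1].

Section Operations.
Context (R : realType) (T : R -> R -> R) (tau : R -> \bar R).
Implicit Types (a b : triple R) (l : R).

Local Notation S := (dual_tconorm T).
Local Notation zeta := (dual_generator tau).
Local Notation tau_inv := (unit_inv tau).
Local Notation zeta_inv := (unit_inv zeta).

Definition pf_add a b : triple R :=
  Triple (S (pmu a) (pmu b))
    (T (peta a + pnu a) (peta b + pnu b) - T (pnu a) (pnu b))
    (T (pnu a) (pnu b)).

Definition pf_mul a b : triple R :=
  Triple (T (pmu a) (pmu b))
    (T (peta a + pmu a) (peta b + pmu b) - T (pmu a) (pmu b))
    (S (pnu a) (pnu b)).

Definition pf_scale l a : triple R :=
  Triple (zeta_inv (l%:E * zeta (pmu a))%E)
    (tau_inv (l%:E * tau (peta a + pnu a))%E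
       - tau_inv (l%:E * tau (pnu a))%E)
    (tau_inv (l%:E * tau (pnu a))%E).

Definition pf_pow a l : triple R :=
  Triple (tau_inv (l%:E * tau (pmu a))%E)
    (tau_inv (l%:E * tau (peta a + pmu a))%E
       - tau_inv (l%:E * tau (pmu a))%E)
    (zeta_inv (l%:E * zeta (pnu a))%E).

(* Neutral element of pf_add on picture fuzzy numbers, so that starting the
   iteration from it does not change the value of a nonempty iterated sum. *)
Definition pf_zero : triple R := Triple 0 0 1.

Definition PFIBM (p q : R) (n : nat) (al : 'I_n -> triple R) : triple R :=
  pf_pow
    (pf_scale ((n * n.-1)%:R^-1)
       (\big[pf_add/pf_zero]_(ij : 'I_n * 'I_n | ij.1 != ij.2)
          pf_mul (pf_pow (al ij.1) p) (pf_pow (al ij.2) q)))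
    ((p + q)^-1).

End Operations.

(* Main.v *)
Require Import Defs.
From mathcomp Require Import all_boot all_order all_algebra.
From mathcomp Require Import all_classical all_reals all_analysis.
From mathcomp Require Import lra.

Set Implicit Arguments.
Unset Strict Implicit.
Unset Printing Implicit Defensive.

Import Order.TTheory GRing.Theory Num.Theory.
Import numFieldNormedType.Exports.

Local Open Scope ring_scope.

(** In the coordinates (mu, eta + nu, nu) the sum and the scalar multiples are
    taken coordinatewise, and in the coordinates (mu, eta + mu, nu) so are the
    product and the powers. A generator turns each coordinate into [0, +oo],
    where T and S become addition and multiples and powers become
    multiplication by a positive scalar. Hence alpha^p (x) alpha^q is
    beta := alpha^(p+q), the sum of N = n(n-1) copies of beta is N . beta, and
    both the factor 1/N and the exponent 1/(p+q) cancel. The only point to check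
    is that beta is again a picture fuzzy number, so that its eta + nu lies in
    the domain of the generator when passing from one kind of coordinates to the
    other. *)

Section Unit.
Context (R : realType).

Lemma unitIP (x : R) : unitI x <-> 0 <= x <= 1.
Proof. by rewrite /unitI/= in_itv. Qed.

Lemma unitI1 : unitI (1 : R).
Proof. by apply/unitIP; rewrite lexx ler01. Qed.

Lemma unitI_onem (x : R) : unitI x -> unitI (1 - x).
Proof. by move=> /unitIP x01; apply/unitIP; lra. Qed.

Lemma is_pfn_unit_etamu (a : triple R) : is_pfn a -> unitI (peta a + pmu a).
Proof.
by case=> /unitIP m01 /unitIP e01 /unitIP n01 s1; apply/unitIP; lra.
Qed.

Lemma is_pfn_unit_etanu (a : triple R) : is_pfn a -> unitI (peta a + pnu a).
Proof.
by case=> /unitIP m01 /unitIP e01 /unitIP n01 s1; apply/unitIP; lra.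
Qed.

End Unit.

(** Fibre over the first index: for each [i], the admissible [j] form the complement of a
    singleton. *)
Lemma card_neq_pair (I : finType) :
  #|[pred ij : I * I | ij.1 != ij.2]| = (#|I| * #|I|.-1)%N.
Proof.
rewrite -sum1_card -(pair_big_dep xpredT (fun i j => i != j) (fun _ _ => 1%N))/=.
under eq_bigr => i _.
  rewrite (eq_bigl (fun j => j \in predC1 i))//; last first.
    by move=> j; rewrite !inE eq_sym.
  rewrite sum1_card cardC1; over.
by rewrite sum_nat_const.
Qed.

Section Generator.
Context (R : realType) (T : R -> R -> R) (tau : R -> \bar R).
Context (htau : additive_generator T tau).
Implicit Types (x y l m : R) (u v : \bar R) (a b : triple R).

Local Notation S := (dual_tconorm T).
Local Notation zeta := (dual_generator tau).
Local Notation tau_inv := (unit_inv tau).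
Local Notation zeta_inv := (unit_inv zeta).

Lemma generator_ge0 x : unitI x -> (0 <= tau x)%E.
Proof.
case: (generator_bij htau) => tauI _ _ /tauI/=.
by rewrite in_itv/= => /andP[].
Qed.

Lemma unit_invK x : unitI x -> tau_inv (tau x) = x.
Proof.
move=> x01; apply: pinvKV; last by rewrite inE.
by case: (generator_bij htau).
Qed.

Lemma unit_inv_surj u : (0 <= u)%E -> exists2 x, unitI x & tau x = u.
Proof.
move=> u0; case: (generator_bij htau) => _ _ tau_surj.
by apply: tau_surj; rewrite /= in_itv/= u0 leey.
Qed.

Lemma generatorK u : (0 <= u)%E -> tau (tau_inv u) = u.
Proof. by case/unit_inv_surj => x x01 <-; rewrite unit_invK. Qed.

Lemma unit_inv_unit u : (0 <= u)%E -> unitI (tau_inv u).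
Proof. by case/unit_inv_surj => x x01 <-; rewrite unit_invK. Qed.

Lemma unit_inv_anti u v : (0 <= u)%E -> (u <= v)%E -> tau_inv v <= tau_inv u.
Proof.
move=> u0 uv; have v0 := le_trans u0 uv.
rewrite leNgt; apply/negP => /(generator_decreasing htau).
move=> /(_ (unit_inv_unit u0) (unit_inv_unit v0)).
by rewrite !generatorK// ltNge uv.
Qed.

Lemma generator_anti x y : unitI x -> unitI y -> x <= y -> (tau y <= tau x)%E.
Proof.
move=> x01 y01; rewrite le_eqVlt => /predU1P[->//|xy].
exact/ltW/(generator_decreasing htau).
Qed.

(** [zeta] is [tau] composed with the reflection x -> 1 - x. The bound on [u] keeps it in the range
    of both maps; outside it both inverses take the default value 0. *)
Lemma unit_inv_dual u : (0 <= u)%E -> zeta_inv u = 1 - tau_inv u.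
Proof.
move=> u0; have x01 := unitI_onem (unit_inv_unit u0).
have {1}-> : u = zeta (1 - tau_inv u).
  by rewrite /dual_generator subKr generatorK.
apply: pinvKV; last by rewrite inE.
case: (generator_bij htau) => _ tau_inj _ x y; rewrite !inE => {}x01 y01 xy.
suff : 1 - x = 1 - y by lra.
by apply: tau_inj xy; rewrite inE; apply: unitI_onem.
Qed.

(** Phrased on values of [tau_inv], the shape in which powers and multiples present their
    coordinates. *)
Lemma tnorm_unit_inv u v : (0 <= u)%E -> (0 <= v)%E ->
  T (tau_inv u) (tau_inv v) = tau_inv (u + v)%E.
Proof.
move=> u0 v0; rewrite (generatorE htau); do ?exact: unit_inv_unit.
by rewrite !generatorK.
Qed.

Lemma dual_tconorm_unit_inv u v : (0 <= u)%E -> (0 <= v)%E ->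
  S (zeta_inv u) (zeta_inv v) = zeta_inv (u + v)%E.
Proof.
move=> u0 v0; rewrite !unit_inv_dual ?adde_ge0// /dual_tconorm !subKr.
by rewrite tnorm_unit_inv.
Qed.

Lemma dual_generatorK u : (0 <= u)%E -> zeta (zeta_inv u) = u.
Proof.
by move=> u0; rewrite /dual_generator unit_inv_dual// subKr generatorK.
Qed.

Lemma dual_unit_invK x : unitI x -> zeta_inv (zeta x) = x.
Proof.
move=> /unitI_onem x01; rewrite unit_inv_dual ?generator_ge0//.
by rewrite /dual_generator unit_invK ?subKr.
Qed.

Lemma dual_generator_ge0 x : unitI x -> (0 <= zeta x)%E.
Proof. by move=> /unitI_onem; apply: generator_ge0. Qed.

Lemma scale_generator_ge0 l x : 0 <= l -> unitI x -> (0 <= l%:E * tau x)%E.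
Proof. by move=> l0 x01; rewrite mule_ge0 ?lee_fin ?generator_ge0. Qed.

Lemma scale_dual_generator_ge0 l x : 0 <= l -> unitI x ->
  (0 <= l%:E * zeta x)%E.
Proof. by move=> l0 x01; rewrite mule_ge0 ?lee_fin ?dual_generator_ge0. Qed.

(** As both scalars are nonnegative, no difference of infinities arises even when [u] is
    infinite. *)
Lemma ge0_EFin_muleDl l m u : 0 <= l -> 0 <= m ->
  (l%:E * u + m%:E * u = (l + m)%:E * u)%E.
Proof. by move=> l0 m0; rewrite EFinD ge0_muleDl ?lee_fin. Qed.

Local Definition ge0s := (scale_generator_ge0, scale_dual_generator_ge0).

(** The map x -> [tau_inv (l * tau x)] is nondecreasing. Applied to mu <= eta + mu it makes the new
    eta nonnegative ([le1]); applied to eta + mu <= 1 - nu it bounds the new total by 1 ([le2]). *)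
Lemma is_pfn_pow a l : is_pfn a -> 0 <= l -> is_pfn (pf_pow tau a l).
Proof.
move=> pa l0; have em01 := is_pfn_unit_etamu pa.
case: (pa) => m01 e01 n01 s1; have n01' := unitI_onem n01.
have le1 : tau_inv (l%:E * tau (pmu a))%E
    <= tau_inv (l%:E * tau (peta a + pmu a))%E.
  apply: unit_inv_anti; first exact: scale_generator_ge0.
  apply: lee_wpmul2l; rewrite ?lee_fin//; apply: generator_anti => //.
  by rewrite lerDr; case/unitIP/andP: e01.
have le2 : tau_inv (l%:E * tau (peta a + pmu a))%E
    <= tau_inv (l%:E * tau (1 - pnu a))%E.
  apply: unit_inv_anti; first exact: scale_generator_ge0.
  by apply: lee_wpmul2l; rewrite ?lee_fin//; apply: generator_anti => //; lra.
have /unitIP := unit_inv_unit (scale_generator_ge0 l0 m01).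
have /unitIP := unit_inv_unit (scale_generator_ge0 l0 em01).
have /unitIP := unit_inv_unit (scale_generator_ge0 l0 n01').
move=> i1 i2 i3; split; rewrite /= ?unit_inv_dual ?ge0s// /dual_generator.
- by apply/unitIP; lra.
- by apply/unitIP; lra.
- by lra.
Qed.

(** In each power, eta + mu telescopes ([subrK]) to a single value of [tau_inv], so all three
    coordinates add through the generator. *)
Lemma pf_mul_pow a l m : is_pfn a -> 0 <= l -> 0 <= m ->
  pf_mul T (pf_pow tau a l) (pf_pow tau a m) = pf_pow tau a (l + m).
Proof.
move=> pa l0 m0; have em01 := is_pfn_unit_etamu pa; case: pa => m01 _ n01 _.
by rewrite /pf_mul /pf_pow/= !subrK !tnorm_unit_inv ?dual_tconorm_unit_inv ?ge0s//
  !ge0_EFin_muleDl.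
Qed.

Lemma pf_pow_pow a l m : is_pfn a -> 0 <= l -> 0 <= m ->
  pf_pow tau (pf_pow tau a l) m = pf_pow tau a (m * l).
Proof.
move=> pa l0 m0; have em01 := is_pfn_unit_etamu pa; case: pa => m01 _ n01 _.
by rewrite /pf_pow/= subrK !generatorK ?dual_generatorK ?ge0s// !muleA -EFinM.
Qed.

Lemma pf_pow1 a : is_pfn a -> pf_pow tau a 1 = a.
Proof.
move=> pa; have em01 := is_pfn_unit_etamu pa; case: pa => m01 _ n01 _.
rewrite /pf_pow !mul1e !unit_invK// dual_unit_invK// addrK.
by case: a {em01 m01 n01}.
Qed.

Lemma pf_add_scale a l m : is_pfn a -> 0 <= l -> 0 <= m ->
  pf_add T (pf_scale tau l a) (pf_scale tau m a) = pf_scale tau (l + m) a.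
Proof.
move=> pa l0 m0; have en01 := is_pfn_unit_etanu pa; case: pa => m01 _ n01 _.
by rewrite /pf_add /pf_scale/= !subrK !tnorm_unit_inv ?dual_tconorm_unit_inv ?ge0s//
  !ge0_EFin_muleDl.
Qed.

Lemma pf_scale_scale a l m : is_pfn a -> 0 <= l -> 0 <= m ->
  pf_scale tau m (pf_scale tau l a) = pf_scale tau (m * l) a.
Proof.
move=> pa l0 m0; have en01 := is_pfn_unit_etanu pa; case: pa => m01 _ n01 _.
by rewrite /pf_scale/= subrK !generatorK ?dual_generatorK ?ge0s// !muleA -EFinM.
Qed.

Lemma pf_scale1 a : is_pfn a -> pf_scale tau 1 a = a.
Proof.
move=> pa; have en01 := is_pfn_unit_etanu pa; case: pa => m01 _ n01 _.
rewrite /pf_scale !mul1e !unit_invK// dual_unit_invK// addrK.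
by case: a {en01 m01 n01}.
Qed.

(* Relies on the library convention 0 * +oo = 0. *)
Lemma pf_scale0 a : pf_scale tau 0 a = pf_zero R.
Proof.
have inv0 : tau_inv 0%E = 1.
  by rewrite -(generator1 htau) unit_invK//; apply: unitI1.
by rewrite /pf_scale !mul0e unit_inv_dual// inv0 subrr.
Qed.

Lemma iter_pf_add a k : is_pfn a ->
  iter k (pf_add T a) (pf_zero R) = pf_scale tau k%:R a.
Proof.
move=> pa; elim: k => [|k IHk]; first by rewrite pf_scale0.
(* The new copy of [a] is read as the multiple 1 . a, so that the scalars add. *)
by rewrite iterS IHk -{1}[a]pf_scale1// pf_add_scale// -nat1r.
Qed.

End Generator.

Theorem mainTheorem3 (R : realType) (n : nat) (T : R -> R -> R)
    (tau : R -> \bar R) (p q : R) (al : 'I_n -> triple R) (a : triple R)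
    (hn : (2 <= n)%N)
    (hT : strict_tnorm T)
    (htau : additive_generator T tau)
    (hp : 0 < p) (hq : 0 < q)
    (hal : forall i, is_pfn (al i))
    (hala : forall i, al i = a) :
  PFIBM T tau p q al = a.
Proof.
(* Index 0 exists since n >= 2. *)
have pa : is_pfn a by rewrite -(hala (Ordinal (ltnW hn))).
have pq0 : 0 < p + q by apply: addr_gt0.
have pb := is_pfn_pow htau pa (ltW pq0).
have N0 : (n * n.-1)%:R != 0 :> R.
  by rewrite pnatr_eq0 muln_eq0; case: n hn {al hal hala} => [|[]].
rewrite /PFIBM; under eq_bigr do rewrite !hala (pf_mul_pow htau)// ?ltW//.
(* The summand no longer depends on the pair, so the sum is [pf_add] iterated n(n-1) times from
   [pf_zero]. *)
rewrite (big_const _ _ [pred ij : 'I_n * 'I_n | ij.1 != ij.2]) card_neq_pair.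
rewrite card_ord (iter_pf_add htau)// (pf_scale_scale htau) ?invr_ge0//.
rewrite mulVf// (pf_scale1 htau)// (pf_pow_pow htau) ?invr_ge0 ?ltW//.
by rewrite mulVf ?gt_eqF// (pf_pow1 htau).
Qed.
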